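(* Let $T$ be the lifetime of a coherent system with identically distributed components, whose lifetimes have the law of a non-negative absolutely continuous random variable $X_1$, and let $q$ be the distortion function of the system. Let $\phi(u)=\frac{1-u^2}{2}$. Then $$B_1\,\bar\eta^1J(X_1)\le \bar\eta^1J(T)\le B_2\,\bar\eta^1J(X_1),$$ where $B_1=\inf_{u\in(0,1)}\frac{\phi(q(u))}{\phi(u)}$ and $B_2=\sup_{u\in(0,1)}\frac{\phi(q(u))}{\phi(u)}$.
   Context: For a non-negative random variable $Z$ with cumulative distribution function $F_Z$, the weighted negative cumulative extropy is $$\bar\eta^1J(Z)=\frac12\int_0^\infty x\,(1-F_Z^2(x))\,dx .$$ For a coherent system with identically distributed (possibly dependent) components having common cumulative distribution function $F$, the lifetime $T$ of the system has cumulative distribution function $F_T(x)=q(F(x))$, where the distortion function $q:[0,1]\to[0,1]$ is a continuous increasing function with $q(0)=0$ and $q(1)=1$, depending only on the structure of the system and the copula of the component lifetimes. The only property of the coherent system that is used is this representation of $F_T$. The supremum $B_2$ is taken in $[0,\infty]$. *)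

(* Defs.v *)
(* MathComp / MathComp-Analysis *)
From HB Require Import structures.
From mathcomp Require Import all_boot all_order all_algebra.
From mathcomp Require Import all_classical all_reals all_analysis.

Set Implicit Arguments.
Unset Strict Implicit.
Unset Printing Implicit Defensive.

Import Order.TTheory GRing.Theory Num.Theory.
Import numFieldNormedType.Exports.

Local Open Scope classical_set_scope.
Local Open Scope ring_scope.

(* The state of an n-component system is the vector recording which components
   are working; a structure function says whether the system is working. *)
Definition coherent (n : nat) (psi : {ffun 'I_n -> bool} -> bool) : Prop :=
  [/\ (0 < n)%N,
      forall x y : {ffun 'I_n -> bool},
        (forall i, x i -> y i) -> psi x -> psi y &
      forall i : 'I_n, exists x : {ffun 'I_n -> bool},
        psi x != psi [ffun j => if j == i then ~~ x j else x j]].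

(* The system works just after time t iff the components whose lifetimes exceed
   t suffice to make it work.  This determines T from X, as the maximum over
   the path sets of the minimum of the component lifetimes. *)
Definition system_lifetime (Omega : Type) (R : realType) (n : nat)
    (psi : {ffun 'I_n -> bool} -> bool) (X : 'I_n -> Omega -> R)
    (T : Omega -> R) : Prop :=
  forall (w : Omega) (t : R), (t < T w) = psi [ffun i => t < X i w].

(* "Increasing" is taken in the weak sense, since the distortion function of a
   system with dependent components may have flat parts.  Only the restriction
   of q to the unit interval matters, which q maps to itself by monotonicity. *)
Definition distortion (R : realType) (q : R -> R) : Prop :=
  [/\ {within `[0, 1], continuous q},
      {in `[0, 1] &, {homo q : u v / u <= v}},
      q 0 = 0 &
      q 1 = 1].

Definition cdfR d (Omega : measurableType d) (R : realType)
    (P : probability Omega R) (Z : {RV P >-> R}) (x : R) : R := fine (cdf Z x).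

Definition weighted_neg_cumulative_extropy d (Omega : measurableType d)
    (R : realType) (P : probability Omega R) (Z : {RV P >-> R}) : \bar R :=
  (2^-1%:E *
   \int[lebesgue_measure]_(x in `[0%R, +oo[) (x * (1 - cdfR Z x ^+ 2))%:E)%E.

Definition phi (R : realType) (u : R) : R := (1 - u ^+ 2) / 2.

Definition B1 (R : realType) (q : R -> R) : \bar R :=
  ereal_inf [set (phi (q u) / phi u)%:E | u in `]0, 1[].

Definition B2 (R : realType) (q : R -> R) : \bar R :=
  ereal_sup [set (phi (q u) / phi u)%:E | u in `]0, 1[].

(* Main.v *)
(* Since x (1 - F(x)^2) = 2 x phi(F(x)), it suffices to prove the pointwise bounds
   B1 phi(u) <= phi(q(u)) <= B2 phi(u) for all u in [0, 1] and to integrate them.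
   They are immediate on ]0, 1[, and at u = 1 all three terms vanish; at u = 0
   they say B1 <= 1 <= B2, which holds because the ratio tends to 1 as u tends
   to 0 from the right.  When B2 is infinite they rely on +oo * 0 = 0. *)
Require Import Defs.
From HB Require Import structures.
From mathcomp Require Import all_boot all_order all_algebra.
From mathcomp Require Import all_classical all_reals all_analysis.
From mathcomp Require Import measurable_realfun ring.

Set Implicit Arguments.
Unset Strict Implicit.
Unset Printing Implicit Defensive.

Import Order.TTheory GRing.Theory Num.Theory.
Import numFieldNormedType.Exports.

Local Open Scope classical_set_scope.
Local Open Scope ring_scope.

Section ratio_bounds.
Context {R : realType}.
Implicit Types (q : R -> R) (u x : R).

Lemma phi_gt0 u : u \in `]0, 1[ -> 0 < phi u.
Proof.
rewrite in_itv/= => /andP[u0 u1]; rewrite /phi divr_gt0// subr_gt0.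
by rewrite expr_lt1// ltW.
Qed.

Lemma phi_ge0 u : 0 <= u -> u <= 1 -> 0 <= phi u.
Proof. by move=> u0 u1; rewrite /phi divr_ge0// subr_ge0 expr_le1. Qed.

Lemma distortion_ge0 q u : distortion q -> 0 <= u -> u <= 1 -> 0 <= q u.
Proof.
by move=> [_ q_nd q0 _] u0 u1; rewrite -q0 q_nd// in_itv/= ?lexx ?ler01 ?u0.
Qed.

Lemma distortion_le1 q u : distortion q -> 0 <= u -> u <= 1 -> q u <= 1.
Proof.
by move=> [_ q_nd _ q1] u0 u1; rewrite -q1 q_nd// in_itv/= ?lexx ?ler01 ?u0.
Qed.

(** Since [q] is right-continuous at 0 and [q 0 = 0], numerator and denominator both tend to
    [phi 0 = 2^-1], which is nonzero. *)
Lemma phi_ratio_cvg0 q : distortion q ->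
  phi (q u) / phi u @[u --> 0^'+] --> (1 : R).
Proof.
move=> [q_cont _ q0 _].
(* Of continuity on the closed interval, the proof keeps the one-sided limit at 0. *)
have [_ + _] := (continuous_within_itvP q ltr01).1 q_cont; rewrite q0 => q_cvg.
(* Stated for a general [f] so as to serve for both [q] and the identity. *)
have phi_cvg (f : R -> R) : f u @[u --> 0^'+] --> (0 : R) ->
    phi (f u) @[u --> 0^'+] --> (2^-1 : R).
  move=> f_cvg; rewrite /phi -[X in _ --> X]mul1r; apply: cvgMr_tmp.
  rewrite -[X in _ --> X]subr0; apply: cvgB; first exact: cvg_cst.
  by rewrite -[X in _ --> X](mulr0 0); under eq_fun do rewrite expr2; apply: cvgM.
rewrite -[X in _ --> X](@divff _ (2^-1 : R))//.
apply: cvgM; first exact: phi_cvg.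
apply: cvgV => //; apply: phi_cvg.
exact: cvg_at_right_filter.
Qed.

Lemma phi_ratio_bounds q u : u \in `]0, 1[ ->
  (B1 q <= (phi (q u) / phi u)%:E <= B2 q)%E.
Proof. by move=> u01; rewrite ereal_inf_lbound ?ereal_sup_ubound//; exists u. Qed.

Lemma phi_ratio_cvge0 q : distortion q ->
  (phi (q u) / phi u)%:E @[u --> 0^'+] --> (1 : R)%:E.
Proof.
move=> dq; apply: cvg_EFin; last exact: phi_ratio_cvg0.
by near=> u.
Unshelve. all: by end_near. Qed.

(** Points close to 0 on the right lie in the open unit interval, where [B1 q] is below the ratio;
    the inequality passes to the limit 1. The bound on [B2] is dual. *)
Lemma B1_le1 q : distortion q -> (B1 q <= 1)%E.
Proof.
move=> dq; apply: cvge_to_ge (phi_ratio_cvge0 dq) _.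
near=> u; suff /andP[] : (B1 q <= (phi (q u) / phi u)%:E <= B2 q)%E by [].
by apply: phi_ratio_bounds; rewrite in_itv/=; apply/andP; split.
Unshelve. all: by end_near. Qed.

Lemma B2_ge1 q : distortion q -> (1 <= B2 q)%E.
Proof.
move=> dq; apply: cvge_to_le (phi_ratio_cvge0 dq) _.
near=> u; suff /andP[] : (B1 q <= (phi (q u) / phi u)%:E <= B2 q)%E by [].
by apply: phi_ratio_bounds; rewrite in_itv/=; apply/andP; split.
Unshelve. all: by end_near. Qed.

(** [q] maps the unit interval to itself, so every ratio is nonnegative. The sign is what lets
    [B1 q] move inside the integral. *)
Lemma B1_ge0 q : distortion q -> (0 <= B1 q)%E.
Proof.
move=> dq; apply: le_ereal_inf_tmp => _ [u /= u01 <-].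
have /andP[u0 u1] : 0 < u < 1 by move: u01; rewrite in_itv.
rewrite lee_fin divr_ge0 ?(ltW (phi_gt0 u01))// phi_ge0//.
  by rewrite distortion_ge0 ?ltW.
by rewrite distortion_le1 ?ltW.
Qed.

Lemma B2_ge0 q : distortion q -> (0 <= B2 q)%E.
Proof. by move=> dq; rewrite (le_trans _ (B2_ge1 dq)). Qed.

Lemma phi_distortion_bounds q u : distortion q -> 0 <= u -> u <= 1 ->
  (B1 q * (phi u)%:E <= (phi (q u))%:E <= B2 q * (phi u)%:E)%E.
Proof.
move=> dq; have [_ _ q0 q1] := dq.
rewrite le_eqVlt => /predU1P[<- _|u0].
  have p0 : (0 <= (phi 0 : R)%:E)%E by rewrite lee_fin phi_ge0.
  rewrite q0; apply/andP; split.
    by rewrite -[leRHS]mul1e lee_wpmul2r// B1_le1.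
  by rewrite -[leLHS]mul1e lee_wpmul2r// B2_ge1.
rewrite le_eqVlt => /predU1P[->|u1].
  by rewrite q1 /phi expr1n subrr mul0r !mule0 lexx.
have u01 : u \in `]0, 1[ by rewrite in_itv/= u0.
have pu := phi_gt0 u01.
(* In the interior [phi u] is positive, so the bounds on the ratio can be multiplied back by it. *)
have -> : phi (q u) = phi (q u) / phi u * phi u by rewrite divfK// gt_eqF.
have /andP[? ?] := phi_ratio_bounds q u01.
have pu0 : (0 <= (phi u)%:E)%E by rewrite lee_fin ltW.
by rewrite (EFinM (phi (q u) / phi u)); apply/andP; split; apply: lee_wpmul2r.
Qed.

End ratio_bounds.

Section extropy.
Context d (Omega : measurableType d) (R : realType) (P : probability Omega R).
Implicit Types Z : {RV P >-> R}.

Lemma cdfR_ge0 Z x : 0 <= cdfR Z x.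
Proof. by rewrite /cdfR fine_ge0. Qed.

Lemma cdfR_le1 Z x : cdfR Z x <= 1.
Proof. by rewrite -lee_fin /cdfR fineK ?fin_num_measure// cdf_le1. Qed.

(** Isolates the weight [2 * x], nonnegative on the domain of integration, from the factor that the
    distortion changes. *)
Lemma extropy_integrandE Z x :
  (x * (1 - cdfR Z x ^+ 2))%:E = ((2 * x)%:E * (phi (cdfR Z x))%:E)%E.
Proof. by rewrite -EFinM /phi; congr EFin; field. Qed.

Lemma extropy_integrand_ge0 Z x : 0 <= x ->
  (0 <= (x * (1 - cdfR Z x ^+ 2))%:E)%E.
Proof.
by move=> x0; rewrite lee_fin mulr_ge0// subr_ge0 expr_le1// ?cdfR_ge0 ?cdfR_le1.
Qed.

Lemma measurable_extropy_integrand Z (D : set R) : measurable D ->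
  measurable_fun D (EFin \o (fun x : R => x * (1 - cdfR Z x ^+ 2))).
Proof.
move=> mD; apply/measurable_EFinP; apply: measurable_funM => //.
apply: measurable_funB => //; apply: measurable_funX.
apply: measurable_funTS.
apply: measurableT_comp (cdf_measurable Z).
exact: fine_measurable.
Qed.

(** The constant is an extended real because [B2 q] may be [+oo]; a nonnegative measurable integrand
    allows scaling even then. *)
Lemma scale_extropyE Z (c : \bar R) : (0 <= c)%E ->
  (c * weighted_neg_cumulative_extropy Z = 2^-1%:E *
   \int[lebesgue_measure]_(x in `[0%R, +oo[) (c * (x * (1 - cdfR Z x ^+ 2))%:E))%E.
Proof.
move=> c0; rewrite /weighted_neg_cumulative_extropy muleCA ge0_integralZl//.
  exact: measurable_extropy_integrand.
by move=> x /=; rewrite in_itv/= andbT => x0; exact: extropy_integrand_ge0.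
Qed.

End extropy.

Theorem proposition8 (R : realType) (d : measure_display)
    (Omega : measurableType d) (P : probability Omega R)
    (X1 : {RV P >-> R})
    (X1_ge0 : {ae P, forall w, 0 <= X1 w})
    (X1_ac : distribution P X1 `<< @lebesgue_measure R)
    (n : nat) (psi : {ffun 'I_n -> bool} -> bool) (psi_coherent : coherent psi)
    (X : 'I_n -> {RV P >-> R})
    (X_law : forall (i : 'I_n) (A : set R),
      measurable A -> distribution P (X i) A = distribution P X1 A)
    (T : {RV P >-> R})
    (T_lifetime : system_lifetime psi (fun i => X i : Omega -> R) T)
    (q : R -> R) (q_distortion : distortion q)
    (T_cdf : forall x : R, cdfR T x = q (cdfR X1 x)) :
  (B1 q * weighted_neg_cumulative_extropy X1
     <= weighted_neg_cumulative_extropy T)%E /\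
  (weighted_neg_cumulative_extropy T
     <= B2 q * weighted_neg_cumulative_extropy X1)%E.
Proof.
have dq := q_distortion.
have bnd (x : R) : 0 <= x ->
    (B1 q * (x * (1 - cdfR X1 x ^+ 2))%:E <= (x * (1 - cdfR T x ^+ 2))%:E <=
     B2 q * (x * (1 - cdfR X1 x ^+ 2))%:E)%E.
  (* With the common weight in front of all three terms, what remains is the bound for [phi] at
     [u = cdfR X1 x]. *)
  move=> x0; rewrite !extropy_integrandE T_cdf !(muleCA _ (2 * x)%:E).
  have /andP[lb ub] := phi_distortion_bounds dq (cdfR_ge0 X1 x) (cdfR_le1 X1 x).
  by rewrite !lee_wpmul2l// lee_fin mulr_ge0.
have mf (Z : {RV P >-> R}) := @measurable_extropy_integrand _ _ _ _ Z `[0, +oo[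
  (measurable_itv _).
(* Once the constant is inside the integral, both sides are half an integral, and [bnd] compares the
   integrands. *)
split.
  rewrite scale_extropyE ?B1_ge0// lee_wpmul2l ?lee_fin//.
  apply: ge0_le_integral => //.
  - move=> x; rewrite /= in_itv/= andbT => x0.
    by rewrite mule_ge0 ?B1_ge0 ?extropy_integrand_ge0.
  - exact: measurable_funeM (mf X1).
  - exact: mf.
  - by move=> x; rewrite /= in_itv/= andbT => /bnd /andP[].
rewrite scale_extropyE ?B2_ge0// lee_wpmul2l ?lee_fin//.
apply: ge0_le_integral => //.
- by move=> x; rewrite /= in_itv/= andbT; exact: extropy_integrand_ge0.
- exact: mf.
- exact: measurable_funeM (mf X1).
- by move=> x; rewrite /= in_itv/= andbT => /bnd /andP[].
Qed.
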